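(* Let $E_1,E_2$ be disjoint finite sets and let $M,N$ be matroids on $E_1$ such that $N$ is a matroid quotient of $M$, i.e. $M\twoheadrightarrow N$. Then for every matroid $\mathscr{C}$ on $E_1\sqcup E_2$, there is a matroid quotient $\mathscr{C}_*(M)\twoheadrightarrow \mathscr{C}_*(N)$ between matroids on $E_2$.
   Context: All matroids are on finite ground sets. For matroids $M,N$ on the same ground set $E$, $N$ is a quotient of $M$, written $M\twoheadrightarrow N$, if every flat of $N$ is a flat of $M$. $\mathrm{Mat}(E)$ denotes the poset category of matroids on $E$, with matroid quotients as morphisms. The union $M\vee N$ is the matroid on $E$ whose independent sets are the sets $I\cup J$ with $I$ independent in $M$ and $J$ independent in $N$. The intersection $M\wedge N$ is the matroid on $E$ dual to the union of the duals of $M$ and $N$; equivalently, its bases are the inclusion-minimal sets among $\{B\cap B' : B \text{ a basis of } M,\ B'\text{ a basis of } N\}$. $\mathbf{B}_{E}$ denotes the Boolean matroid on $E$ (its only basis is $E$), $\oplus$ denotes direct sum and $\setminus$ denotes deletion. For a matroid $\mathscr{C}$ on $E_1\sqcup E_2$, the matroid correspondence $\mathscr{C}_*$ sends a matroid $M$ on $E_1$ to the matroid $\mathscr{C}_*(M):=\big((M\oplus \mathbf{B}_{E_2})\wedge \mathscr{C}\big)\setminus E_1$ on $E_2$. *)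

(* Defs.v *)
From mathcomp Require Import all_boot.

Set Implicit Arguments.
Unset Strict Implicit.
Unset Printing Implicit Defensive.

(* The ground set of a matroid is a whole finite type; accordingly the disjoint
   union of two ground sets E1 and E2 is the sum type E1 + E2. *)
Record matroid (E : finType) := Matroid {
  indep : {set {set E}};
  indep0 : set0 \in indep;
  indepS : forall I J : {set E}, I \subset J -> J \in indep -> I \in indep;
  indep_aug : forall I J : {set E}, I \in indep -> J \in indep -> #|I| < #|J| ->
    exists2 x, x \in J :\: I & x |: I \in indep
}.

Definition bases (E : finType) (M : matroid E) : {set {set E}} :=
  [set B | maxset (mem (indep M)) B].

Definition rank (E : finType) (M : matroid E) (A : {set E}) : nat :=
  \max_(I in indep M | I \subset A) #|I|.

Definition flat (E : finType) (M : matroid E) (F : {set E}) : bool :=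
  [forall x, (x \notin F) ==> (rank M F < rank M (x |: F))].

Definition quotient (E : finType) (M N : matroid E) : Prop :=
  forall F : {set E}, flat N F -> flat M F.

Section Bases.
Variables (E : finType) (M : matroid E).

Lemma basesP (B : {set E}) :
  reflect (B \in indep M /\ forall I, I \in indep M -> #|I| <= #|B|)
          (B \in bases M).
Proof.
rewrite inE; apply: (iffP idP) => [/maxsetP[iB maxB] | [iB maxB]].
  split=> // I iI; rewrite leqNgt; apply/negP=> ltBI.
  have [x /setDP[_ xB] iBx] := indep_aug iB iI ltBI.
  by move: xB; rewrite -(maxB _ iBx (subsetUr _ _)) setU11.
apply/maxsetP; split=> // I iI sBI; apply/esym/eqP.
by rewrite eqEcard sBI maxB.
Qed.

Lemma indep_extend (I J : {set E}) : I \in indep M -> J \in indep M ->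
  exists2 K, K \in indep M & [/\ I \subset K, K \subset I :|: J & #|J| <= #|K|].
Proof.
move=> iI iJ; have [k] := ubnP (#|J| - #|I|); elim: k I iI => // k IHk I iI.
rewrite ltnS => le_k; have [leJI | ltIJ] := leqP #|J| #|I|.
  by exists I => //; rewrite subxx subsetUl.
have [x /setDP[xJ xI] iIx] := indep_aug iI iJ ltIJ.
have [|K iK [sIK sKJ leJK]] := IHk _ iIx.
  rewrite cardsU1 xI add1n; apply: leq_trans le_k; rewrite subnS prednK //.
  by rewrite subn_gt0.
exists K => //; split=> //; first exact: subset_trans (subsetUr _ _) sIK.
apply: subset_trans sKJ _; rewrite !subUset sub1set inE xJ orbT /=.
by rewrite subsetUl subsetUr.
Qed.

Lemma ex_base : exists B, B \in bases M.
Proof.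
have [B maxB _] := @maxset_exists _ (mem (indep M)) set0 (indep0 M).
by exists B; rewrite inE.
Qed.

Lemma base_extend (I B : {set E}) : I \in indep M -> B \in bases M ->
  exists2 K, K \in bases M & I \subset K /\ K \subset I :|: B.
Proof.
move=> iI /basesP[iB maxB]; have [K iK [sIK sKB leBK]] := indep_extend iI iB.
by exists K => //; apply/basesP; split=> // J /maxB /leq_trans->.
Qed.

End Bases.

Section Dual.
Variables (E : finType) (M : matroid E).

Definition dual_indep : {set {set E}} :=
  [set A : {set E} | [exists B in bases M, A \subset ~: B]].

Lemma dual_indepP (A : {set E}) :
  reflect (exists2 B, B \in bases M & A \subset ~: B) (A \in dual_indep).
Proof. by rewrite inE; apply: exists_inP. Qed.

Fact dual_indep0 : set0 \in dual_indep.
Proof.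
by have [B bB] := ex_base M; apply/dual_indepP; exists B; rewrite ?sub0set.
Qed.

Fact dual_indepS (I J : {set E}) :
  I \subset J -> J \in dual_indep -> I \in dual_indep.
Proof.
move=> sIJ /dual_indepP[B bB sJB]; apply/dual_indepP.
by exists B => //; apply: subset_trans sJB.
Qed.

Fact dual_indep_aug (I J : {set E}) :
  I \in dual_indep -> J \in dual_indep -> #|I| < #|J| ->
  exists2 x, x \in J :\: I & x |: I \in dual_indep.
Proof.
move=> /dual_indepP[B bB sIB] /dual_indepP[C bC sJC] ltIJ.
have /basesP[iC maxC] := bC.
have iCI : C :\: I \in indep M by apply: indepS iC; apply: subsetDl.
have [K bK [sCK sKB]] := base_extend iCI bB.
have sIK : I \subset ~: K.
  rewrite subsetC; apply: subset_trans sKB _.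
  by rewrite subUset setDE subsetIr /= subsetC.
have [sJK | /subsetPn[x JIx xK]] := boolP (J :\: I \subset K); last first.
  exists x => //; apply/dual_indepP; exists K => //.
  by rewrite subUset sub1set inE xK.
have dJC : [disjoint J & C] by rewrite disjoints_subset.
have : #|(C :\: I) :|: (J :\: I)| <= #|C|.
  apply: leq_trans (subset_leq_card _) (maxC K _); first by rewrite subUset sCK.
  by case/basesP: bK.
rewrite cardsU (_ : _ :&: _ = set0) ?cards0 ?subn0; last first.
  apply/setP=> x; rewrite !inE; apply/negP=> /andP[/andP[_ Cx] /andP[_ Jx]].
  by rewrite (disjointFr dJC Jx) in Cx.
have sCI : #|C :&: I| <= #|I :\: J|.
  apply/subset_leq_card/subsetP=> x; rewrite !inE => /andP[Cx ->].
  by rewrite andbT; apply: contraL Cx => Jx; rewrite (disjointFr dJC Jx).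
move: ltIJ sCI; rewrite -(cardsID I C) -(cardsID J I) -(cardsID I J) (setIC J).
rewrite ltn_add2l => ltIJ leCI; rewrite addnC leq_add2r => leJC.
by have := leq_ltn_trans (leq_trans leJC leCI) ltIJ; rewrite ltnn.
Qed.

Definition dual : matroid E := Matroid dual_indep0 dual_indepS dual_indep_aug.

Lemma bases_dual (B : {set E}) : (B \in bases dual) = (~: B \in bases M).
Proof.
apply/idP/idP=> [|bB].
  rewrite inE => /maxsetP[/dual_indepP[C bC sBC] maxB].
  rewrite -(maxB (~: C) _ sBC) ?setCK //.
  by apply/dual_indepP; exists C.
rewrite inE; apply/maxsetP; split.
  by apply/dual_indepP; exists (~: B); rewrite ?setCK.
move=> A /dual_indepP[C bC sAC] sBA; apply/esym/eqP.
rewrite eqEsubset sBA /= -setCS.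
have sCB : C \subset ~: B by rewrite subsetC; apply: subset_trans sAC.
suff -> : ~: B = C by rewrite subsetC.
apply/esym/eqP; rewrite eqEcard sCB /=.
by case/basesP: bC => _; apply; case/basesP: bB.
Qed.

End Dual.

Section Union.
Variables (E : finType) (M N : matroid E).

Definition union_indep : {set {set E}} :=
  [set I :|: J | I in indep M, J in indep N].

Lemma union_indepP (A : {set E}) :
  reflect (exists I J, [/\ I \in indep M, J \in indep N & A = I :|: J])
          (A \in union_indep).
Proof.
apply: (iffP imset2P) => [[I J iI iJ ->] | [I [J [iI iJ ->]]]].
  by exists I, J.
by exists I J.
Qed.

Fact union_indep0 : set0 \in union_indep.
Proof. by apply/union_indepP; exists set0, set0; rewrite !indep0 setU0. Qed.

Fact union_indepS (A B : {set E}) :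
  A \subset B -> B \in union_indep -> A \in union_indep.
Proof.
move=> sAB /union_indepP[I [J [iI iJ defB]]]; apply/union_indepP.
exists (A :&: I), (A :&: J); split; try by apply: indepS (subsetIr _ _) _.
by rewrite -setIUr -defB; apply/esym/setIidPl.
Qed.

Lemma union_indep_disjoint (A : {set E}) : A \in union_indep ->
  exists I J, [/\ I \in indep M, J \in indep N, [disjoint I & J] & A = I :|: J].
Proof.
case/union_indepP=> [I [J [iI iJ ->]]]; exists I, (J :\: I); split=> //.
- by apply: indepS iJ; apply: subsetDl.
- by rewrite disjoints_subset setDE setCI setCK subsetUr.
- by rewrite setDE setUIr setUCr setIT.
Qed.

Fact union_indep_aug (A B : {set E}) :
  A \in union_indep -> B \in union_indep -> #|A| < #|B| ->
  exists2 x, x \in B :\: A & x |: A \in union_indep.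
Proof.
move=> /union_indep_disjoint[I1 [I2 [iI1 iI2 dI ->]]].
move=> /union_indep_disjoint[J1 [J2 [iJ1 iJ2 dJ ->]]].
have [k] := ubnP (#|I1 :&: J2| + #|I2 :&: J1|).
elim: k I1 I2 iI1 iI2 dI => // k IHk I1 I2 iI1 iI2 dI; rewrite ltnS => le_k ltIJ.
have cardU (X Y : {set E}) : [disjoint X & Y] -> #|X :|: Y| = #|X| + #|Y|.
  by rewrite -setI_eq0 cardsU => /eqP->; rewrite cards0 subn0.
have [lt1 | le1] := ltnP #|I1| #|J1|.
  have [x /setDP[J1x I1x] iI1x] := indep_aug iI1 iJ1 lt1.
  have J2x : x \in J2 = false by rewrite (disjointFr dJ J1x).
  have [I2x | I2x] := boolP (x \in I2); last first.
    exists x; first by rewrite !inE J1x negb_or I1x I2x.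
    by apply/union_indepP; exists (x |: I1), I2; rewrite setUA.
  have defI : x |: I1 :|: I2 :\ x = I1 :|: I2.
    by rewrite setUAC setD1K // setUC.
  rewrite -defI; apply: IHk; rewrite ?defI //.
  - by apply: indepS iI2; apply: subD1set.
  - rewrite disjoints_subset subUset sub1set !inE eqxx /=.
    by rewrite -disjoints_subset (disjointWr _ dI) ?subD1set.
  apply: leq_trans le_k; rewrite -addnS leq_add //.
    apply/subset_leq_card/subsetP=> y; rewrite !inE.
    by case: eqP => [->|] //=; rewrite J2x andbF.
  by rewrite [leqRHS](cardsD1 x) inE I2x J1x setIDAC.
have lt2 : #|I2| < #|J2|.
  rewrite ltnNge; apply/negP=> le2.
  by move: ltIJ; rewrite !cardU // ltnNge leq_add.
have [x /setDP[J2x I2x] iI2x] := indep_aug iI2 iJ2 lt2.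
have J1x : x \in J1 = false by rewrite (disjointFl dJ J2x).
have [I1x | I1x] := boolP (x \in I1); last first.
  exists x; first by rewrite !inE J2x negb_or I1x I2x orbT.
  by apply/union_indepP; exists I1, (x |: I2); rewrite setUCA.
have defI : I1 :\ x :|: (x |: I2) = I1 :|: I2.
  by rewrite setUCA setUA setD1K.
rewrite -defI; apply: IHk; rewrite ?defI //.
- by apply: indepS iI1; apply: subD1set.
- rewrite disjoint_sym disjoints_subset subUset sub1set !inE eqxx /=.
  by rewrite -disjoints_subset disjoint_sym (disjointWl _ dI) ?subD1set.
apply: leq_trans le_k; rewrite -addSn leq_add //.
  by rewrite [leqRHS](cardsD1 x) inE I1x J2x setIDAC.
apply/subset_leq_card/subsetP=> y; rewrite !inE.
by case: eqP => [->|] //=; rewrite J1x andbF.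
Qed.

Definition union : matroid E :=
  Matroid union_indep0 union_indepS union_indep_aug.

End Union.

Definition intersection (E : finType) (M N : matroid E) : matroid E :=
  dual (union (dual M) (dual N)).

Section Boolean.
Variable E : finType.

Fact boolean_indep0 : set0 \in [set: {set E}].
Proof. by rewrite inE. Qed.

Fact boolean_indepS (I J : {set E}) :
  I \subset J -> J \in [set: {set E}] -> I \in [set: {set E}].
Proof. by rewrite !inE. Qed.

Fact boolean_indep_aug (I J : {set E}) :
  I \in [set: {set E}] -> J \in [set: {set E}] -> #|I| < #|J| ->
  exists2 x, x \in J :\: I & x |: I \in [set: {set E}].
Proof.
move=> _ _ ltIJ; have [x Jx Ix] : exists2 x, x \in J & x \notin I.
  apply/subsetPn; apply: contraL ltIJ => sJI.
  by rewrite -leqNgt subset_leq_card.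
by exists x; rewrite inE ?Ix.
Qed.

Definition boolean : matroid E :=
  Matroid boolean_indep0 boolean_indepS boolean_indep_aug.

Lemma bases_boolean : bases boolean = [set setT].
Proof.
apply/setP=> B; rewrite !inE; apply/maxsetP/eqP=> [[_ maxB] | ->].
  by rewrite -(maxB setT) ?inE ?subsetT.
by split=> [|J _]; rewrite ?inE // subTset => /eqP.
Qed.

End Boolean.

Section DirectSum.
Variables (E1 E2 : finType) (M : matroid E1) (N : matroid E2).
Implicit Types A B : {set E1 + E2}.

Definition dsum_indep : {set {set E1 + E2}} :=
  [set A : {set E1 + E2} | (inl @^-1: A \in indep M) && (inr @^-1: A \in indep N)].

Lemma card_sum_set A : #|A| = #|inl @^-1: A| + #|inr @^-1: A|.
Proof.
rewrite -(card_imset (inl @^-1: A) (@inl_inj E1 E2)).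
rewrite -(card_imset (inr @^-1: A) (@inr_inj E1 E2)).
rewrite -cardsUI (_ : _ :&: _ = set0) ?cards0 ?addn0.
  congr #|pred_of_set _|; apply/setP=> -[] x; rewrite inE.
    rewrite (mem_imset _ _ inl_inj) inE; case: imsetP => [[]|_] //.
    by rewrite orbF.
  by rewrite (mem_imset _ _ inr_inj) inE; case: imsetP => [[]|_].
apply/setP=> y; rewrite !inE; apply/negP=> /andP[/imsetP[a _ ->]].
by case/imsetP.
Qed.

Fact dsum_indep0 : set0 \in dsum_indep.
Proof. by rewrite inE !preimset0 !indep0. Qed.

Fact dsum_indepS A B : A \subset B -> B \in dsum_indep -> A \in dsum_indep.
Proof.
move=> sAB; rewrite !inE => /andP[iM iN].
by rewrite (indepS _ iM) ?(indepS _ iN) ?preimsetS.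
Qed.

Fact dsum_indep_aug A B :
  A \in dsum_indep -> B \in dsum_indep -> #|A| < #|B| ->
  exists2 x, x \in B :\: A & x |: A \in dsum_indep.
Proof.
rewrite !inE => /andP[iA1 iA2] /andP[iB1 iB2]; rewrite !card_sum_set => ltAB.
have [lt1 | le1] := ltnP #|inl @^-1: A| #|inl @^-1: B|.
  have [x Dx iAx] := indep_aug iA1 iB1 lt1.
  exists (inl x); first by move: Dx; rewrite !inE.
  rewrite inE (_ : inl @^-1: _ = x |: inl @^-1: A).
    rewrite iAx (_ : inr @^-1: _ = inr @^-1: A) //.
    by apply/setP=> y; rewrite !inE.
  by apply/setP=> y; rewrite !inE (inj_eq inl_inj).
have lt2 : #|inr @^-1: A| < #|inr @^-1: B|.
  by rewrite ltnNge; apply: contraL ltAB => le2; rewrite -leqNgt leq_add.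
have [x Dx iAx] := indep_aug iA2 iB2 lt2.
exists (inr x); first by move: Dx; rewrite !inE.
rewrite inE (_ : inl @^-1: _ = inl @^-1: A); last first.
  by apply/setP=> y; rewrite !inE.
rewrite iA1 (_ : inr @^-1: _ = x |: inr @^-1: A) //.
by apply/setP=> y; rewrite !inE (inj_eq inr_inj).
Qed.

Definition dsum : matroid (E1 + E2)%type :=
  Matroid dsum_indep0 dsum_indepS dsum_indep_aug.

End DirectSum.

Section Deletion.
Variables (E1 E2 : finType) (M : matroid (E1 + E2)%type).
Implicit Types A B : {set E2}.

(* The independent sets of the deletion are the independent sets of M that do
   not meet E1, regarded as subsets of E2. *)
Definition deletel_indep : {set {set E2}} :=
  [set A : {set E2} | inr @: A \in indep M].

Fact deletel_indep0 : set0 \in deletel_indep.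
Proof. by rewrite inE imset0 indep0. Qed.

Fact deletel_indepS A B :
  A \subset B -> B \in deletel_indep -> A \in deletel_indep.
Proof. by move=> sAB; rewrite !inE; apply: indepS; apply: imsetS. Qed.

Fact deletel_indep_aug A B :
  A \in deletel_indep -> B \in deletel_indep -> #|A| < #|B| ->
  exists2 x, x \in B :\: A & x |: A \in deletel_indep.
Proof.
rewrite !inE => iA iB ltAB.
have [|_ /setDP[/imsetP[x Bx ->]]] := indep_aug iA iB.
  by rewrite !card_imset //; apply: inr_inj.
rewrite (mem_imset _ _ inr_inj) => Ax iAx.
by exists x; rewrite ?inE ?Ax // imsetU1.
Qed.

Definition deletel : matroid E2 :=
  Matroid deletel_indep0 deletel_indepS deletel_indep_aug.

End Deletion.

Definition correspondence (E1 E2 : finType) (C : matroid (E1 + E2)%type)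
    (M : matroid E1) : matroid E2 :=
  deletel (intersection (dsum M (boolean E2)) C).

(* Main.v *)
Require Import Defs.
From mathcomp Require Import all_boot.
From mathcomp Require Import zify.

(** A quotient is an inequality between rank functions: [M] maps onto [N] iff
    every increment of the rank of [N] along [A \subset B] is at most the
    corresponding increment of the rank of [M] ([quotient_rankP]).  In this form
    quotients are visibly preserved by direct sums and deletions, and reversed
    by duality, since each of these operations changes rank functions by an
    explicit formula.  As [C_*] is composed of a direct sum, duals, a union and
    a deletion, it remains to see that union with a fixed matroid [R] preserves
    quotients.

    This follows from the matroid union theorem ([rank_union_le],
    [rank_union_min]): the rank of [A] in [M \/ R] is the minimum over [X] of
    [rank M X + rank R X + #|A :\: X|].  If [X] attains the minimum for [B] in
    [M \/ R] and [Y] attains it for [A] in [N \/ R], then [X :|: Y] and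
    [X :&: Y] give upper bounds for the rank of [B] in [N \/ R] and of [A] in
    [M \/ R]; submodularity together with the rank inequality between [M] and
    [N] on [Y \subset X :|: Y] shows that these bounds are good enough. *)

(** * Rank functions *)

Section Rank.
Context {E : finType} (M : matroid E).
Implicit Types A B I : {set E}.

Lemma rank_ge A I : I \in indep M -> I \subset A -> #|I| <= rank M A.
Proof. by move=> iI sIA; apply: leq_bigmax_cond; rewrite iI. Qed.

Lemma rank_le A n :
  (forall I, I \in indep M -> I \subset A -> #|I| <= n) -> rank M A <= n.
Proof. by move=> le_n; apply/bigmax_leqP=> I /andP[]; apply: le_n. Qed.

Lemma rank_witness A :
  exists I, [/\ I \in indep M, I \subset A & #|I| = rank M A].
Proof.
have card0 : 0 < #|[pred I | (I \in indep M) && (I \subset A)]|.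
  by apply/card_gt0P; exists set0; rewrite inE indep0 sub0set.
have [I /andP[iI sIA] rI] := eq_bigmax_cond (fun I : {set E} => #|I|) card0.
by exists I; rewrite -rI.
Qed.

Lemma rankS {A B} : A \subset B -> rank M A <= rank M B.
Proof.
move=> sAB; apply: rank_le => I iI sIA.
by apply: rank_ge => //; apply: subset_trans sAB.
Qed.

Lemma card_base A : A \in bases M -> #|A| = rank M setT.
Proof.
case/basesP=> iA maxA; apply/eqP; rewrite eqn_leq rank_ge ?subsetT //=.
by apply: rank_le => I /maxA.
Qed.

Lemma rank_submod A B :
  rank M (A :|: B) + rank M (A :&: B) <= rank M A + rank M B.
Proof.
have [I [iI sI <-]] := rank_witness (A :&: B).
have [J [iJ sJ <-]] := rank_witness (A :|: B).
have [K iK [sIK sKU leJK]] := indep_extend iI iJ.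
have {}sKU : K \subset A :|: B.
  apply: subset_trans sKU _; rewrite subUset sJ andbT.
  by apply: subset_trans sI _; rewrite subIset ?subsetUl.
apply: (@leq_trans (#|K :&: A| + #|K :&: B|)); last first.
  by apply: leq_add; apply: rank_ge; rewrite ?subsetIr //;
     apply: indepS iK; apply: subsetIl.
rewrite -(cardsUI (K :&: A)) -setIUr (setIidPl sKU); apply: leq_add => //.
by apply: subset_leq_card; rewrite -setIIr subsetI sIK.
Qed.

End Rank.

(** * Quotients as rank inequalities *)

(** One direction tests the inequality on [F \subset x |: F].  For the other, it
    is enough to add one element [x] at a time to [A]; if [x] raises the rank in
    [N], it lies outside the flat [F] of [N] spanned by [A]; as [F] is also a flat
    of [M], [x] raises the rank of [F], and by submodularity that of [A], in
    [M]. *)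
Lemma quotient_rankP {E : finType} {M N : matroid E} :
  quotient M N <->
  forall A B : {set E}, A \subset B ->
    rank N B + rank M A <= rank M B + rank N A.
Proof.
split=> [qMN A B sAB | leMN F /forallP flatF]; last first.
  apply/forallP=> x; apply/implyP=> xF.
  have := implyP (flatF x) xF; have := leMN F (x |: F) (subsetUr _ _); lia.
have step x (D : {set E}) :
    rank N (x |: D) + rank M D <= rank M (x |: D) + rank N D.
  have sD := subsetUr [set x] D.
  have [le_x | gt_x] := leqP (rank N (x |: D)) (rank N D).
    by have := rankS M sD; lia.
  have [F maxF sDF] :
      {F | maxset (fun S => rank N S <= rank N D) F & D \subset F}.
    exact: maxset_exists.
  have /maxsetP[leF maximalF] := maxF.
  have flatF : flat N F.
    apply/forallP=> y; apply/implyP=> yF; rewrite ltnNge; apply/negP=> le_y.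
    move: yF; rewrite -(maximalF (y |: F)) ?setU11 ?subsetUr //.
    exact: leq_trans le_y leF.
  have xF : x \notin F.
    apply: contraL gt_x => Fx; rewrite -leqNgt; apply: leq_trans leF.
    by apply: rankS; rewrite subUset sub1set Fx.
  have rF := implyP (forallP (qMN _ flatF) x) xF.
  have subm := rank_submod M (x |: D) F.
  have rU : rank M (x |: F) <= rank M (x |: D :|: F).
    by apply: rankS; rewrite -setUA setUS ?subsetUr.
  have rI : rank M D <= rank M ((x |: D) :&: F).
    by apply: rankS; rewrite subsetI sD.
  have r1 : rank N (x |: D) <= (rank N D).+1.
    apply: rank_le => I iI sI.
    have : #|I :\ x| <= rank N D.
      apply: rank_ge; first by apply: indepS iI; apply: subD1set.
      by rewrite subDset.
    by rewrite (cardsD1 x I); lia.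
  lia.
have [n] := ubnP #|B :\: A|; elim: n A sAB => // n IHn A sAB.
rewrite ltnS => le_n; have [/eqP | [x]] := set_0Vmem (B :\: A).
  rewrite setD_eq0 => sBA; suff -> : A = B by rewrite addnC.
  by apply/eqP; rewrite eqEsubset sAB.
move=> xBA; have /setDP[xB _] := xBA.
have sxB : x |: A \subset B by rewrite subUset sub1set xB.
have smaller : #|B :\: (x |: A)| < n.
  by move: le_n; rewrite (cardsD1 x) xBA setDDl setUC.
by have := step x A; have := IHn _ sxB smaller; lia.
Qed.

(** * Duality *)

Lemma rank_dual {E : finType} (M : matroid E) (A : {set E}) :
  rank (dual M) A + rank M setT = #|A| + rank M (~: A).
Proof.
apply/eqP; rewrite eqn_leq; apply/andP; split.
  have [I [/dual_indepP[B bB sIB] sIA <-]] := rank_witness (dual M) A.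
  rewrite -(card_base _ _ bB) -(cardsID A B) addnA leq_add //.
    rewrite -cardsUI (_ : I :&: _ = set0) ?cards0 ?addn0.
      by apply: subset_leq_card; rewrite subUset sIA subsetIr.
    apply/eqP; rewrite setI_eq0 disjoints_subset; apply: subset_trans sIB _.
    by rewrite setCS subsetIl.
  apply: rank_ge; last by rewrite setDE subsetIr.
  by case/basesP: bB => iB _; apply: indepS iB; apply: subsetDl.
have [I [iI sIA <-]] := rank_witness M (~: A).
have [B0 bB0] := ex_base M; have [B bB [sIB _]] := base_extend iI bB0.
rewrite -(card_base _ _ bB) -(cardsID A B) -(cardsID B A) (setIC B).
have : #|A :\: B| <= rank (dual M) A.
  apply: rank_ge; last exact: subsetDl.
  by apply/dual_indepP; exists B => //; rewrite setDE subsetIr.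
have : #|I| <= #|B :\: A|.
  by apply: subset_leq_card; rewrite setDE subsetI sIB.
lia.
Qed.

(** Passing to complements turns the increment along [A \subset B] into the one
    along [~: B \subset ~: A]. *)
Lemma quotient_dual {E : finType} {M N : matroid E} :
  quotient M N -> quotient (dual N) (dual M).
Proof.
move=> /quotient_rankP leMN; apply/quotient_rankP=> A B sAB.
have := leMN (~: B) (~: A); rewrite setCS => /(_ sAB).
have := (rank_dual M A, rank_dual M B, rank_dual N A, rank_dual N B).
by case=> [[[]]]; lia.
Qed.

(** * The matroid union theorem *)

Section UnionRank.
Context {E : finType} (M N : matroid E).
Implicit Types A U V X Y : {set E}.

Lemma rank_union_le A X :
  rank (union M N) A <= rank M X + rank N X + #|A :\: X|.
Proof.
have [K [indK sKA <-]] := rank_witness (union M N) A.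
have /union_indepP[I [J [iI iJ defK]]] := indK.
rewrite -(cardsID X K) leq_add //; last by apply/subset_leq_card/setSD.
rewrite defK setIUl; apply: leq_trans (leq_card_setU _ _) _.
by apply: leq_add; apply: rank_ge; rewrite ?subsetIr //;
  [apply: indepS iI | apply: indepS iJ]; apply: subsetIl.
Qed.

(** The lower bound [k] is kept while [M] is restricted to [U] and [N] to [V],
    until [U] and [V] are disjoint; then bases of [U] and [V] have a union of
    size at least [k].  An element [e] of both can always be removed from one
    of them: if removing [e] from [U] violates the bound at [X] and removing it
    from [V] violates it at [Y], then by submodularity the bound is already
    violated at [X :|: Y] or at [(X :&: Y) :\ e]. *)
Lemma rank_union_ge_restr A k U V : U \subset A -> V \subset A ->
  (forall X, k <= rank M (X :&: U) + rank N (X :&: V) + #|A :\: X|) ->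
  k <= rank (union M N) A.
Proof.
have [n] := ubnP #|U :&: V|; elim: n U V => // n IHn U V.
rewrite ltnS => le_n sUA sVA bound.
have [UV0 | [e eUV]] := set_0Vmem (U :&: V).
  have := bound A; rewrite setDv cards0 addn0 (setIidPr sUA) (setIidPr sVA).
  move/leq_trans; apply.
  have [I [iI sIU <-]] := rank_witness M U.
  have [J [iJ sJV <-]] := rank_witness N V.
  rewrite -cardsUI (_ : I :&: J = set0) ?cards0 ?addn0.
    apply: rank_ge; first by apply/union_indepP; exists I, J.
    by rewrite subUset (subset_trans sIU) // (subset_trans sJV).
  by apply/eqP; rewrite -subset0 -UV0 setISS.
have /setIP[eU eV] := eUV.
have smaller : #|(U :&: V) :\ e| < n.
  by move: le_n; rewrite (cardsD1 e (U :&: V)) eUV.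
pose loss U' V' X := rank M (X :&: U') + rank N (X :&: V') + #|A :\: X|.
have [/forallP okU | /forallPn[X]] := boolP [forall X, k <= loss (U :\ e) V X].
  apply: (IHn (U :\ e) V) => //; first by rewrite setIDAC.
  exact: subset_trans (subD1set _ _) sUA.
have [/forallP okV | /forallPn[Y]] := boolP [forall X, k <= loss U (V :\ e) X].
  move=> _; apply: (IHn U (V :\ e)) => //; first by rewrite setIDA.
  exact: subset_trans (subD1set _ _) sVA.
rewrite -!ltnNge /loss => badY badX; exfalso.
have eX : e \in X.
  apply: contraLR badX => eX; rewrite -leqNgt; apply: leq_trans (bound X) _.
  rewrite !leq_add2r; apply/rankS/subsetP=> y; rewrite !inE.
  by case: eqP => // ->; rewrite (negPf eX).
have eY : e \in Y.
  apply: contraLR badY => eY; rewrite -leqNgt; apply: leq_trans (bound Y) _.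
  rewrite leq_add2r leq_add2l; apply/rankS/subsetP=> y; rewrite !inE.
  by case: eqP => // ->; rewrite (negPf eY).
have bU := bound (X :|: Y); have bI := bound ((X :&: Y) :\ e).
have := rank_submod M (X :&: (U :\ e)) (Y :&: U).
have := rank_submod N (X :&: V) (Y :&: (V :\ e)).
have -> : X :&: (U :\ e) :|: Y :&: U = (X :|: Y) :&: U.
  by apply/setP=> y; rewrite !inE; case: eqP => [->|]; rewrite ?eX ?eY ?eU //;
     rewrite andb_orl.
have -> : X :&: V :|: Y :&: (V :\ e) = (X :|: Y) :&: V.
  by apply/setP=> y; rewrite !inE; case: eqP => [->|]; rewrite ?eX ?eY ?eV //;
     rewrite andb_orl.
have -> : X :&: (U :\ e) :&: (Y :&: U) = ((X :&: Y) :\ e) :&: U.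
  by apply/setP=> y; rewrite !inE; do !case: (_ \in _); case: eqP.
have -> : X :&: V :&: (Y :&: (V :\ e)) = ((X :&: Y) :\ e) :&: V.
  by apply/setP=> y; rewrite !inE; do !case: (_ \in _); case: eqP.
have cXY : #|A :\: (X :|: Y)| + #|A :\: (X :&: Y)| = #|A :\: X| + #|A :\: Y|.
  by rewrite setDUr setDIr addnC cardsUI.
have ce : #|A :\: ((X :&: Y) :\ e)| = #|A :\: (X :&: Y)|.+1.
  rewrite (cardsD1 e) !inE eqxx (subsetP sUA e eU) /=.
  congr (_.+1); congr #|pred_of_set _|; apply/setP=> y; rewrite !inE.
  by case: eqP => [->|]; rewrite ?eX ?eY.
lia.
Qed.

(** The value attained by the witness is the rank, by [rank_union_le]. *)
Lemma rank_union_min A :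
  exists X, rank M X + rank N X + #|A :\: X| <= rank (union M N) A.
Proof.
apply/existsP; apply: contraT => /existsPn gtA.
suff : rank (union M N) A < rank (union M N) A by rewrite ltnn.
apply: (rank_union_ge_restr A _ A A) => // X.
have := gtA (X :&: A); rewrite -ltnNge => /leq_trans; apply.
by rewrite setDIr setDv setU0.
Qed.

End UnionRank.

(** * Preservation of quotients *)

Lemma quotient_union {E : finType} {M N : matroid E} (R : matroid E) :
  quotient M N -> quotient (union M R) (union N R).
Proof.
move=> /quotient_rankP leMN; apply/quotient_rankP=> A B sAB.
have [X minX] := rank_union_min M R B.
have [Y minY] := rank_union_min N R A.
have := rank_union_le N R B (X :|: Y).
have := rank_union_le M R A (X :&: Y).
have := leMN Y (X :|: Y) (subsetUr _ _).
have := rank_submod M X Y; have := rank_submod R X Y.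
have := cardsUI (A :\: X) (A :\: Y); rewrite -setDIr -setDUr.
(* Inside A the corrections for X, Y and for their union and intersection
   balance exactly; on B :\: A, where only X and the union count, an inequality
   is enough. *)
have cardDA (S : {set E}) : #|B :\: S| = #|A :\: S| + #|(B :\: A) :\: S|.
  rewrite -(cardsID A (B :\: S)) setIDAC (setIidPr sAB).
  by congr (_ + #|pred_of_set _|); apply/setP=> y; rewrite !inE andbCA.
have := cardDA X; have := cardDA (X :|: Y).
have : #|(B :\: A) :\: (X :|: Y)| <= #|(B :\: A) :\: X|.
  by apply/subset_leq_card/setDS/subsetUl.
lia.
Qed.

Lemma quotient_intersection {E : finType} {M N : matroid E} (R : matroid E) :
  quotient M N -> quotient (intersection M R) (intersection N R).
Proof. by move=> qMN; apply/quotient_dual/quotient_union/quotient_dual. Qed.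

Lemma rank_dsum {E1 E2 : finType} (M : matroid E1) (R : matroid E2)
    (A : {set E1 + E2}) :
  rank (dsum M R) A = rank M (inl @^-1: A) + rank R (inr @^-1: A).
Proof.
apply/eqP; rewrite eqn_leq; apply/andP; split.
  apply: rank_le => I; rewrite inE => /andP[iI1 iI2] sIA.
  by rewrite card_sum_set leq_add // rank_ge // preimsetS.
have [I [iI sI <-]] := rank_witness M (inl @^-1: A).
have [J [iJ sJ <-]] := rank_witness R (inr @^-1: A).
pose K : {set E1 + E2} :=
  [set x | match x with inl a => a \in I | inr b => b \in J end].
have KI : inl @^-1: K = I by apply/setP=> x; rewrite !inE.
have KJ : inr @^-1: K = J by apply/setP=> x; rewrite !inE.
rewrite -KI -KJ -card_sum_set; apply: rank_ge; first by rewrite inE KI KJ iI.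
apply/subsetP=> -[] x; rewrite inE => Kx.
  by have := subsetP sI x Kx; rewrite inE.
by have := subsetP sJ x Kx; rewrite inE.
Qed.

Lemma quotient_dsum {E1 E2 : finType} {M N : matroid E1} (R : matroid E2) :
  quotient M N -> quotient (dsum M R) (dsum N R).
Proof.
move=> /quotient_rankP leMN; apply/quotient_rankP=> A B sAB.
rewrite !rank_dsum addnACA [leqRHS]addnACA.
rewrite [rank R _ + rank R _]addnC leq_add2r.
by apply/leMN/preimsetS.
Qed.

Lemma rank_deletel {E1 E2 : finType} (M : matroid (E1 + E2)%type)
    (A : {set E2}) :
  rank (deletel M) A = rank M (inr @: A).
Proof.
apply/eqP; rewrite eqn_leq; apply/andP; split.
  apply: rank_le => I; rewrite inE => iI sIA.
  by rewrite -(card_imset I (@inr_inj E1 E2)) rank_ge // imsetS.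
apply: rank_le => I iI sIA.
have defI : inr @: (inr @^-1: I) = I.
  apply/setP=> x; apply/imsetP/idP=> [[y Iy ->] | Ix].
    by rewrite inE in Iy.
  by have /imsetP[y _ defx] := subsetP sIA x Ix; exists y; rewrite // inE -defx.
rewrite -defI card_imset; last exact: inr_inj.
apply: rank_ge; first by rewrite inE defI.
apply/subsetP=> y; rewrite inE => /(subsetP sIA).
by rewrite (mem_imset _ _ inr_inj).
Qed.

Lemma quotient_deletel {E1 E2 : finType} {M N : matroid (E1 + E2)%type} :
  quotient M N -> quotient (deletel M) (deletel N).
Proof.
move=> /quotient_rankP leMN; apply/quotient_rankP=> A B sAB.
by rewrite !rank_deletel; apply: leMN; apply: imsetS.
Qed.

Theorem proposition2p3 (E1 E2 : finType) (M N : matroid E1)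
    (C : matroid (E1 + E2)%type) :
  quotient M N -> quotient (correspondence C M) (correspondence C N).
Proof.
by move=> qMN; apply/quotient_deletel/quotient_intersection/quotient_dsum.
Qed.
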